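(* Let $DB$ be a finite uncertain sequential database. For every nonempty sequence $\alpha$, $$expSup^{cap}(\alpha)\ \le\ expSupport^{top}(\alpha).$$
   Context: Let $I$ be a finite set of items with a fixed total (lexicographic) order. An event is a nonempty finite subset of $I$, and a sequence is a finite ordered list of events $\alpha=\langle e_1 e_2\cdots e_r\rangle$. The length of $\alpha$ is its total number of item occurrences $\sum_j |e_j|$. Items inside an event are listed in lexicographic order, so a sequence of length $m$ has a well-defined list of items $i_1,\dots,i_m$. For $0\le k\le m$, $\alpha_k$ denotes the prefix of $\alpha$ consisting of its first $k$ items ($\alpha_0$ is empty, $\alpha_m=\alpha$). Each $\alpha_k$ is obtained from $\alpha_{k-1}$ by appending $i_k$, either as an s-extension ($i_k$ is added as a new event at the end) or as an i-extension ($i_k$ is inserted in the last event of $\alpha_{k-1}$, where it is lexicographically larger than all items already there). Subsequence: $\langle e_1\cdots e_r\rangle\subseteq\langle f_1\cdots f_n\rangle$ if there are indices $j_1<\dots<j_r$ with $e_t\subseteq f_{j_t}$ for all $t$. Such an index tuple is called an embedding. An uncertain sequence $S$ is a sequence $\langle f_1\cdots f_n\rangle$ together with an existential probability in $(0,1]$ for each item of each event. An uncertain sequential database $DB$ is a finite collection of uncertain sequences (called data sequences). The support of a sequence in $DB$ is the number of data sequences of $DB$ that contain it as a subsequence. Projected database: $DB|\beta$ is the projection of $DB$ with prefix $\beta$ in the sense of PrefixSpan. It consists of the data sequences containing $\beta$, each restricted to the places at which $\beta$ can be extended ($DB|\beta=DB$ for $\beta$ empty). Concretely, for an item $i$ appended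 to $\beta$ and a data sequence $S=\langle f_1\cdots f_n\rangle$, the admissible positions are: - for an s-extension, the indices $j$ with $i\in f_j$ such that $\beta$ has an embedding in $S$ using only events with index $<j$ (if $\beta$ is empty, all $j$ with $i\in f_j$); - for an i-extension, the indices $j$ with $i\in f_j$ such that $\beta$ has an embedding in $S$ whose last event is mapped to $f_j$. In the projected database $DB|\beta$, $maxPr_S(i)$ denotes the maximum existential probability of $i$ in $S$ over the admissible positions ($0$ if there is none), and $\widehat P_{DB|\beta}(i)=\max_{S}maxPr_S(i)$. For $\alpha$ of length $m\geq 1$ with items $i_1,\dots,i_m$, set $$maxPr(\alpha)=\prod_{k=1}^{m}\widehat P_{DB|\alpha_{k-1}}(i_k),\qquad maxPr(\text{empty sequence})=1,$$ $$expSup^{cap}(\alpha)=maxPr(\alpha_{m-1})\times\sum_{S\in DB|\alpha_{m-1}}maxPr_S(i_m),$$ where each $i_k$ is appended to $\alpha_{k-1}$ by the extension type with which it occurs in $\alpha$, and $maxPr_S(i_m)$ is evaluated in the projected database $DB|\alpha_{m-1}$. The upper bound $expSupport^{top}$ is $$expSupport^{top}(\alpha)=maxPr(\alpha_{m-1})\times maxPr(i_m)\times sup_{i_m},$$ where $maxPr(i_m)=maxPr(\langle (i_m)\rangle)$ is the maximum existential probability of the item $i_m$ in $DB$, and $sup_{i_m}$ is the support count of $i_m$, i.e. the number of data sequences of $DB$ in which $i_m$ occurs. *)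

(* Defs.v *)
From HB Require Import structures.
From mathcomp Require Import all_boot all_order all_algebra.
Set Implicit Arguments.
Unset Strict Implicit.
Unset Printing Implicit Defensive.
Import Order.TTheory GRing.Theory Num.Theory.

(* The items are the elements of I.  A sequence is an a : seq {set I} all of  *)
(* whose events are nonempty; the definitions below are total on              *)
(* seq {set I}.                                                               *)

Definition is_sequence (I : finType) (a : seq {set I}) : bool := set0 \notin a.

Section Items.
Context {d : Order.disp_t} {I : finOrderType d}.
Implicit Types (e : {set I}) (a b : seq {set I}) (i : I) (k : nat).

Definition event_items e : seq I := sort <=%O (enum e).

Definition items a : seq I := flatten [seq event_items e | e <- a].

(* The sequence a_k formed by the first k items of a; for #|e| <= k, take     *)
(* keeps all of e.                                                            *)
Fixpoint seq_prefix k a : seq {set I} :=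
  if a is e :: a' then
    if k is 0 then [::]
    else [set x in take k (event_items e)] :: seq_prefix (k - #|e|) a'
  else [::].

Variant extension := SExt | IExt.

(* Indices are 0-based: ext_type a k is the way in which item number k of     *)
(* [items a] is appended to a_k to form a_(k+1).                              *)
Definition ext_type a k : extension :=
  if size (seq_prefix k a) < size (seq_prefix k.+1 a) then SExt else IExt.

Definition last_item a : option I := ohead (rev (items a)).

End Items.

Local Open Scope ring_scope.

(* An uncertain sequence <f_0 ... f_(n-1)>; uprob j is meaningful only on the *)
(* items of f_j.                                                              *)
Record useq (R : realFieldType) (I : finType) := USeq {
  ulen : nat;
  uevent : 'I_ulen -> {set I};
  uprob : 'I_ulen -> I -> R;
  uevent_neq0 : forall j, uevent j != set0;
  uprob_itv : forall j i, i \in uevent j -> 0 < uprob j i <= 1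
}.
Arguments uevent {R I} u j.
Arguments uprob {R I} u j i.

Section Support.
Context {R : realFieldType} {d : Order.disp_t} {I : finOrderType d}.
Implicit Types (S : useq R I) (DB : seq (useq R I)).
Implicit Types (a b : seq {set I}) (x : extension) (i : I).

Definition embedding b S (t : {ffun 'I_(size b) -> 'I_(ulen S)}) : bool :=
  [forall k : 'I_(size b), forall l : 'I_(size b), (k < l)%N ==>
    (t k < t l)%N] &&
  [forall k : 'I_(size b), nth set0 b k \subset uevent S (t k)].
Arguments embedding b S t : clear implicits.

Definition contains S b : bool := [exists t, embedding b S t].

Definition occurs S i : bool := [exists j, i \in uevent S j].

Definition item_support DB i : nat := count (occurs^~ i) DB.

(* A projected database is represented by the data sequences containing b;    *)
(* the restriction to the places where b can be extended is carried by        *)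
(* admissible, which therefore takes b as an argument.                        *)
Definition projected DB b : seq (useq R I) := [seq S <- DB | contains S b].

Definition admissible S b x i (j : 'I_(ulen S)) : bool :=
  (i \in uevent S j) &&
  match x with
  | SExt => [exists t, embedding b S t &&
                       [forall k : 'I_(size b), (t k < j)%N]]
  | IExt => [exists t, embedding b S t &&
                       [exists k : 'I_(size b), (k.+1 == size b) && (t k == j)]]
  end.

Definition maxPrS S b x i : R :=
  \big[Num.max/0]_(j < ulen S | admissible b x i j) uprob S j i.

Definition hatP DB b x i : R :=
  \big[Num.max/0]_(S <- projected DB b) maxPrS S b x i.

Definition maxPr DB a : R :=
  \prod_(k < size (items a))
    hatP DB (seq_prefix k a) (ext_type a k) (tnth (in_tuple (items a)) k).

(* The value 0 for the empty sequence, here and in expSuptop, is arbitrary.   *)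
Definition expSupcap DB a : R :=
  if last_item a is Some i then
    let m1 := (size (items a)).-1 in
    let b := seq_prefix m1 a in
    maxPr DB b * \sum_(S <- projected DB b) maxPrS S b (ext_type a m1) i
  else 0.

Definition expSuptop DB a : R :=
  if last_item a is Some i then
    maxPr DB (seq_prefix (size (items a)).-1 a) * maxPr DB [:: [set i]]
      * (item_support DB i)%:R
  else 0.

End Support.

Arguments embedding {R d I} b S t.
Arguments admissible {R d I} S b x i j.

(* Main.v *)
(** Forgetting the prefix only enlarges the set of admissible positions, so every
    [maxPr_S(i_m)] is at most [maxPr(i_m)], and it vanishes on the data sequences
    that do not contain [i_m]. *)
Require Import Defs.
From mathcomp Require Import all_boot all_order all_algebra.
Import Order.TTheory GRing.Theory Num.Theory.
Local Open Scope ring_scope.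

(** Both sides share the nonnegative factor [maxPr] of the prefix without its last item, so it
    suffices to bound the sum of the [maxPrS] ([sum_maxPrS_le]). Each term is at most the maximum
    over the whole database, and only sequences in which the item occurs contribute, so the sum is
    at most maximum times support. *)

Lemma sum_le_bigmax_count {R : realFieldType} {T : Type} (s : seq T)
    (P Q : pred T) (F G : T -> R) :
    (forall x, P x -> Q x -> F x <= G x) ->
    (forall x, P x -> ~~ Q x -> F x <= 0) ->
  \sum_(x <- s | P x) F x <= \big[Num.max/0]_(x <- s) G x * (count Q s)%:R.
Proof.
move=> leFG leF0; set M := \big[_/_]_(x <- s) G x.
have M_ge0 : 0 <= M by apply: bigmax_ge_id.
rewrite -sum1_count natr_sum big_distrr /= [leRHS]big_mkcond [leLHS]big_mkcond.
(* Summing over positions in [s] gives a finite index type, as [le_bigmax] requires; [M_ge0] then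
   settles positions satisfying [Q] but not [P]. *)
rewrite [leLHS]big_tnth [leRHS]big_tnth; apply: ler_sum => k _; rewrite mulr1.
have leGM : G (tnth (in_tuple s) k) <= M by rewrite /M big_tnth; apply: le_bigmax.
case: ifP => [Pk|_]; case: ifPn => // Qk.
- exact: le_trans (leFG _ Pk Qk) leGM.
- exact: leF0.
Qed.

Section UpperBound.
Context {R : realFieldType} {d : Order.disp_t} {I : finOrderType d}.
Implicit Types (S : useq R I) (DB : seq (useq R I)).
Implicit Types (a b : seq {set I}) (x : extension) (i : I).

Lemma hatP_ge0 DB b x i : 0 <= hatP DB b x i.
Proof. exact: bigmax_ge_id. Qed.

Lemma maxPr_ge0 DB a : 0 <= maxPr DB a.
Proof. by apply: prodr_ge0 => k _; apply: hatP_ge0. Qed.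

Lemma embedding_nil S : embedding [::] S (ffun0 (card_ord 0)).
Proof. by apply/andP; split; apply/forallP => -[]. Qed.

Lemma projected_nil DB : projected DB [::] = DB.
Proof.
rewrite /projected (eq_filter (a2 := predT)) ?filter_predT // => S.
by apply/existsP; eexists; apply: embedding_nil.
Qed.

Lemma admissible_nil S i j : admissible S [::] SExt i j = (i \in uevent S j).
Proof.
rewrite /admissible; case: (i \in _) => //=; apply/existsP.
exists (ffun0 (card_ord 0)); apply/andP; split; first exact: embedding_nil.
by apply/forallP => -[].
Qed.

Lemma maxPrS_le_nil S b x i : maxPrS S b x i <= maxPrS S [::] SExt i.
Proof.
apply: bigmax_le => [|j /andP[ij _]]; first exact: bigmax_ge_id.
by apply: (le_bigmax_cond 0 (uprob S ^~ i)); rewrite admissible_nil.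
Qed.

Lemma maxPrS_notin S b x i : ~~ occurs S i -> maxPrS S b x i = 0.
Proof.
move=> /existsPn iS; rewrite /maxPrS big_pred0 // => j.
by rewrite /admissible (negPf (iS j)).
Qed.

(** The product has one factor, whose prefix is empty; since the first item opens a new event,
    [ext_type] computes to [SExt]. *)
Lemma maxPr_set1 DB i : maxPr DB [:: [set i]] = hatP DB [::] SExt i.
Proof.
have items1 : items [:: [set i]] = [:: i].
  by rewrite /items /= /event_items enum_set1.
by rewrite /maxPr items1 big_ord1 (tnth_nth i).
Qed.

Lemma sum_maxPrS_le DB b x i :
  \sum_(S <- projected DB b) maxPrS S b x i
    <= maxPr DB [:: [set i]] * (item_support DB i)%:R.
Proof.
rewrite maxPr_set1 /hatP projected_nil big_filter.
(* Here [P] is containment of [b], left by the projection, and [Q] is occurrence of [i], which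
   [item_support] counts. *)
apply: sum_le_bigmax_count => S _ => [_|/maxPrS_notin-> //].
exact: maxPrS_le_nil.
Qed.

End UpperBound.

Theorem lemma2 (R : realFieldType) (d : Order.disp_t) (I : finOrderType d)
  (DB : seq (useq R I)) (alpha : seq {set I})
  (alpha_seq : is_sequence alpha) (alpha_neq0 : alpha != [::]) :
  expSupcap DB alpha <= expSuptop DB alpha.
Proof.
rewrite /expSupcap /expSuptop; case: last_item => // i.
rewrite -mulrA; apply: ler_wpM2l; first exact: maxPr_ge0.
exact: sum_maxPrS_le.
Qed.
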